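(* Let $\mathcal{H}=\Delta+V$ be a positive Schrödinger operator associated to a connected graph $b$ over $(X,m)$ with potential $V\le1$. Assume further that $\Delta$ is subcritical and that $G_0$, the minimal positive Green function of $\Delta$, is proper and of bounded oscillation. Let $u\in O(G_0^{1/2})$ be an $\mathcal{H}$-harmonic function satisfying $$\liminf_{x\to\infty}\frac{|u(x)|}{G_1(x)}=0.$$ Then $u=0$.
   Context: Setting. $X$ is an infinite countable set with the discrete topology (compact subsets are the finite subsets), and $m:X\to(0,\infty)$ is a strictly positive function, regarded as a measure of full support. A graph $b$ over $(X,m)$ is a symmetric function $b:X\times X\to[0,\infty)$ with zero diagonal and $\sum_{y\in X}b(x,y)<\infty$ for all $x\in X$. Write $x\sim y$ if $b(x,y)>0$; $b$ is connected if any two vertices are joined by a finite path $x=x_0\sim\dots\sim x_n=y$. Let $\mathcal{F}_b=\{f:X\to\mathbb{R}\mid \sum_{y}b(x,y)|f(y)|<\infty \text{ for all }x\in X\}$. The Laplacian is $\Delta f(x)=\Delta_{b,m}f(x)=\frac1{m(x)}\sum_{y\in X}b(x,y)(f(x)-f(y))$ for $f\in\mathcal{F}_b$. A potential is a function $V:X\to\mathbb{R}$, and the Schrödinger operator associated to $b$ and $V$ is $\mathcal{H}f=\Delta f+Vf$, $f\in\mathcal{F}_b$. A function $u$ is $\mathcal{H}$-harmonic (resp. superharmonic) if $u\in\mathcal{F}_b$ and $\mathcal{H}u=0$ (resp. $\ge0$) on $X$. A function $f$ is called positive if $f\ge0$ and $f\neq0$, strictly positive (written $f>0$) if $f(x)>0$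 for all $x$. $\mathcal{H}$ is positive if there is a positive $\mathcal{H}$-superharmonic function on $X$; equivalently, the energy form $\mathcal{Q}(\varphi)=\frac12\sum_{x,y}b(x,y)(\varphi(x)-\varphi(y))^2+\sum_x m(x)V(x)\varphi(x)^2$ is nonnegative for all finitely supported $\varphi$. A positive $\mathcal{H}$ is subcritical if there is a nontrivial $W\ge0$ with $\mathcal{Q}(\varphi)\ge\sum_x m(x)W(x)\varphi(x)^2$ for all finitely supported $\varphi$. Fix a vertex $o\in X$ and let $1_o$ be the characteristic function of $\{o\}$. For $\alpha>0$, the Green function $G_\alpha$ of $\Delta+\alpha$ at $o$ is the smallest strictly positive function $\phi$ with $(\Delta+\alpha)\phi\ge1_o$; it satisfies $(\Delta+\alpha)G_\alpha=1_o$ and $G_\alpha=(L+\alpha)^{-1}1_o$, where $L$ is the positive selfadjoint operator on $\ell^2(X,m)$ associated to the closure of the form $\varphi\mapsto\frac12\sum_{x,y}b(x,y)(\varphi(x)-\varphi(y))^2$ on finitely supported functions. $G_0=\lim_{\alpha\searrow0}(L+\alpha)^{-1}1_o$ (pointwise limit), which is finite and strictly positive when $\Delta$ is subcritical. A function $\phi:X\to(0,\infty)$ is proper if $\phi^{-1}(I)$ is finite for every compact $I\subset(0,\infty)$; it is of bounded oscillation if $\sup_{x\sim y}\phi(x)/\phi(y)<\infty$. The limit $x\to\infty$ is taken in the one-point compactification $X\cup\{\infty\}$ (i.e. $x$ leaves every finite set). For $g$ not vanishing outside a finite set, $f\in O(g)$ means $\limsup_{x\to\infty}|f(x)|/|g(x)|<\infty$.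 *)

(* Defs.v *)
From HB Require Import structures.
From mathcomp Require Import all_boot all_order all_algebra.
From mathcomp Require Import all_classical all_reals all_analysis.

Set Implicit Arguments.
Unset Strict Implicit.
Unset Printing Implicit Defensive.

Import Order.TTheory GRing.Theory Num.Theory.
Import numFieldNormedType.Exports.

Local Open Scope classical_set_scope.
Local Open Scope ring_scope.

Section Graphs.
Context {R : realType} {X : discreteTopologicalType}.
Implicit Types (b : X -> X -> R) (m V W f g u phi : X -> R) (o x y : X).

(* Only meaningful for absolutely summable families: [fine] turns a divergent
   total into 0. *)
Definition real_sum (f : X -> R) : R :=
  fine (\esum_(x in [set: X]) (EFin \o f)^\+ x
        - \esum_(x in [set: X]) (EFin \o f)^\- x)%E.

Definition is_graph b : Prop :=
  [/\ forall x y, 0 <= b x y,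
      forall x y, b x y = b y x,
      forall x, b x x = 0
    & forall x, (\esum_(y in [set: X]) (b x y)%:E < +oo)%E].

Definition adj b : rel X := fun x y => 0 < b x y.

Definition connected_graph b : Prop :=
  forall x y, exists2 p : seq X, path (adj b) x p & last x p = y.

(* The space F_b on which the formal Laplacian is defined. *)
Definition in_domain b f : Prop :=
  forall x, (\esum_(y in [set: X]) (b x y * `|f y|)%:E < +oo)%E.

(* For f in F_b the family y |-> b x y * (f x - f y) is absolutely summable. *)
Definition laplacian b m f : X -> R :=
  fun x => (m x)^-1 * real_sum (fun y => b x y * (f x - f y)).

Definition schrodinger b m V f : X -> R :=
  fun x => laplacian b m f x + V x * f x.

Definition schrodinger_harmonic b m V u : Prop :=
  in_domain b u /\ forall x, schrodinger b m V u x = 0.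

Definition schrodinger_superharmonic b m V u : Prop :=
  in_domain b u /\ forall x, 0 <= schrodinger b m V u x.

Definition positive_fun f : Prop :=
  (forall x, 0 <= f x) /\ exists x, f x != 0.

Definition strictly_positive_fun f : Prop := forall x, 0 < f x.

Definition positive_operator b m V : Prop :=
  exists2 u, positive_fun u & schrodinger_superharmonic b m V u.

Definition finitely_supported phi : Prop := finite_set [set x | phi x != 0].

(* For finitely supported phi the double series converges and the other sum is
   finite; a finitary sum over [set: X] is by convention 0 if the support of
   its summand is infinite. *)
Definition energy b m V phi : R :=
  2^-1 * fine (\esum_(p in [set: X * X])
                 (b p.1 p.2 * (phi p.1 - phi p.2) ^+ 2)%:E)
  + \sum_(x \in [set: X]) m x * V x * phi x ^+ 2.

Definition subcritical b m V : Prop :=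
  positive_operator b m V /\
  exists2 W, positive_fun W &
    forall phi, finitely_supported phi ->
      \sum_(x \in [set: X]) m x * W x * phi x ^+ 2 <= energy b m V phi.

Definition green_supersolution b m (a : R) o : set (X -> R) :=
  [set phi | [/\ strictly_positive_fun phi, in_domain b phi
    & forall x, \1_[set o] x <= schrodinger b m (fun=> a) phi x]].

Definition is_green b m (a : R) o : set (X -> R) :=
  [set g | green_supersolution b m a o g /\
    forall phi, green_supersolution b m a o phi -> forall x, g x <= phi x].

(* The least element of [green_supersolution], which is unique and exists for
   a > 0. *)
Definition green b m (a : R) o : X -> R := xget (fun=> 0) (is_green b m a o).

(* The limit is finite if the Laplacian is subcritical; [lim] is a junk value
   at the points where the limit is infinite. *)
Definition green0 b m o : X -> R :=
  fun x => lim (green b m a o x @[a --> 0^'+]).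

Definition proper_fun phi : Prop :=
  forall I : set R, compact I -> I `<=` [set r | 0 < r] ->
    finite_set (phi @^-1` I).

Definition bounded_oscillation b phi : Prop :=
  has_ubound [set r | exists x y, adj b x y /\ r = phi x / phi y].

(* Traces on X of the neighbourhoods of the added point of the one-point
   compactification of the discrete space X. *)
Definition at_infinity : set_system X := [set A | cofinite_set A].

Definition in_bigO f g : Prop :=
  (limf_esup (fun x => (`|f x| / `|g x|)%:E) at_infinity < +oo)%E.

End Graphs.

(* Main.v *)
Require Import Defs.
From HB Require Import structures.
From mathcomp Require Import all_boot all_order all_algebra.
From mathcomp Require Import all_classical all_reals all_analysis.
From mathcomp Require Import ring lra.

Set Implicit Arguments.
Unset Strict Implicit.
Unset Printing Implicit Defensive.

Import Order.TTheory GRing.Theory Num.Theory.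
Import numFieldNormedType.Exports.

Local Open Scope classical_set_scope.
Local Open Scope ring_scope.

(** Let [w] be the positive part of [u] and [v > 0] a superharmonic function of
    the operator [H = Delta + V].  For a finitely supported [psi >= 0], the
    energy of [w psi] can be estimated through either factorization
    [w psi = v eta]: since [v] is superharmonic and [w] is subharmonic,

      sum b(x,y) v(x) v(y) (eta(x) - eta(y))^2
        <= sum b(x,y) w(x) w(y) (psi(x) - psi(y))^2

    ([ground_state_comparison]).  As [w <= K sqrt(G_0)], the right-hand side is
    at most [K^2] times the same sum with [w] replaced by [sqrt(G_0)], and this
    weight admits cutoffs of vanishing energy, namely
    [psi_n = clamp (2 + ln G_0 / (n + 1))].  Indeed the geometric mean is
    controlled by the logarithmic one, so that the sum is at most [2 / (n + 1)]
    times

      sum b(x,y) (G_0(x) - G_0(y)) (psi_n(x) - psi_n(y)),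

    which the Green formula bounds by twice the mass of the pole of [G_0]
    ([flux_energy_le], [cutoff_energy]).  The [psi_n] are finitely supported
    because [G_0] is proper and bounded by its value at the pole, and they
    increase to 1.  Letting [n] tend to infinity edge by edge, [w / v] is
    constant ([ratio_constant]): if [u] is positive somewhere, it is positive
    everywhere.

    In that case [V <= 1] makes [u] superharmonic for [Delta + 1], and then the
    minimum of [G_1] and of the multiple of [u] which agrees with [G_1] at [o]
    competes in the minimality of [G_1] ([green_le_superharmonic]).  Hence [G_1]
    is at most a multiple of [u], against the hypothesis on the lower limit.
    So [u <= 0], and the same holds for [- u].

    This uses the Green functions through their extremal properties only.  For
    [a > 0], [G_a] is the infimum of all supersolutions, a set which contains a
    constant ([greenP]), and minimality turns the defining inequality into an
    equality ([green_subsolution]).  The limit [G_0] is finite since all [G_a]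
    lie below one supersolution of [Delta], obtained from below as the supremum
    of the finitely supported subsolutions of [Delta f = 1_o]: their values are
    controlled by their energy, by subcriticality ([point_le_dirichlet]), and
    their energy by their value at [o], by the Green formula
    ([finite_subsolution_bound]). *)

(** * Unordered sums *)

Section EsumComplements.
Context {R : realType}.

Lemma esumZ (T : choiceType) (c : R) (a : T -> \bar R) : 0 <= c ->
  (forall x, 0 <= a x)%E ->
  (\esum_(x in [set: T]) (c%:E * a x) = c%:E * \esum_(x in [set: T]) a x)%E.
Proof.
move=> c0 a0.
have half d (f : T -> \bar R) : 0 <= d -> (forall x, 0 <= f x)%E ->
    (\esum_(x in [set: T]) (d%:E * f x) <= d%:E * \esum_(x in [set: T]) f x)%E.
  move=> d0 f0; apply: ge_ereal_sup => _ [A [finA _] <-].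
  rewrite -ge0_mule_fsumr//; apply: lee_wpmul2l; first by rewrite lee_fin.
  by apply: ereal_sup_ubound; exists A.
apply/eqP; rewrite eq_le half//=.
have [->|c_neq0] := eqVneq c 0.
  by rewrite mul0e; apply: esum_ge0 => x _; rewrite mul0e.
have c_gt0 : 0 < c by rewrite lt0r c_neq0.
rewrite -lee_pdivlMl// (le_trans _ (half _ _ _ _))//.
- rewrite le_eqVlt; apply/orP; left; apply/eqP; apply: eq_esum => x _.
  by rewrite muleA -EFinM mulVf// mul1e.
- by rewrite invr_ge0.
- by move=> x; apply: mule_ge0; rewrite ?lee_fin.
Qed.

Lemma le_esum_term (T : choiceType) (a : T -> \bar R) x :
  (forall y, 0 <= a y)%E -> (a x <= \esum_(y in [set: T]) a y)%E.
Proof.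
move=> a0; apply: esum_ge; exists [set x]; first by split.
by rewrite fsbig_set1.
Qed.

Lemma esum_pair (S T : choiceType) (a : S -> T -> \bar R) :
  (forall x y, 0 <= a x y)%E ->
  (\esum_(p in [set: S * T]) a p.1 p.2
   = \esum_(x in [set: S]) \esum_(y in [set: T]) a x y)%E.
Proof.
move=> a0; rewrite esum_esum//; congr esum.
by apply/seteqP; split => -[x y].
Qed.

Lemma esum_swap (T : choiceType) (a : T -> T -> \bar R) :
  (\esum_(p in [set: T * T]) a p.1 p.2
   = \esum_(p in [set: T * T]) a p.2 p.1)%E.
Proof.
rewrite (@reindex_esum _ _ _ [set: T * T] [set: T * T]
  (fun p => (p.2, p.1)) (fun p => a p.1 p.2))//.
split=> //; first by move=> [? ?] [? ?] _ _ [-> ->].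
by move=> [x y] _; exists (y, x).
Qed.

Lemma esum_lty_finite_support (T : choiceType) (a : T -> \bar R) :
  finite_set [set x | a x != 0%E] -> (forall x, 0 <= a x < +oo)%E ->
  (\esum_(x in [set: T]) a x < +oo)%E.
Proof.
move=> fina a0.
rewrite (_ : \esum_(x in _) _ = \esum_(x in [set x | a x != 0%E]) a x)%E.
  rewrite esum_fset//; last by move=> x _; case/andP: (a0 x).
  rewrite fsbig_finite// lte_sum_pinfty// => x _.
  by case/andP: (a0 x).
rewrite [RHS]esum_mkcond; apply: eq_esum => x _.
by case: ifPn => //; rewrite notin_setE/= => /negP; rewrite negbK => /eqP.
Qed.

Lemma real_sumB (T : discreteTopologicalType) (f g : T -> R) :
  (forall x, 0 <= f x) -> (forall x, 0 <= g x) ->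
  (\esum_(x in [set: T]) (f x)%:E < +oo)%E ->
  (\esum_(x in [set: T]) (g x)%:E < +oo)%E ->
  real_sum (fun x => f x - g x) =
  fine (\esum_(x in [set: T]) (f x)%:E) - fine (\esum_(x in [set: T]) (g x)%:E).
Proof.
move=> f0 g0 sf sg; rewrite /real_sum.
have sumE (h : T -> R) : (forall x, 0 <= h x) ->
    (\esum_(x in [set: T]) (h x)%:E < +oo)%E ->
    summable [set: T] (EFin \o h).
  move=> h0; rewrite /summable; congr (_ < _)%E.
  by apply: eq_esum => x _ /=; rewrite ger0_norm.
have -> : EFin \o (fun x => f x - g x) = ((EFin \o f) \- (EFin \o g))%E by [].
rewrite esumB; [|exact: sumE|exact: sumE|by move=> x _; rewrite lee_fin f0
  |by move=> x _; rewrite lee_fin g0].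
have fin (h : T -> R) : (forall x, 0 <= h x) ->
    (\esum_(x in [set: T]) (h x)%:E < +oo)%E ->
    (\esum_(x in [set: T]) (h x)%:E)%E \is a fin_num.
  move=> h0 sh; rewrite ge0_fin_numE//; apply: esum_ge0 => x _.
  by rewrite lee_fin; exact: h0.
by rewrite fineB//; exact: fin.
Qed.

Lemma summable_pos_neg_fin_num (T : choiceType) (f : T -> \bar R) :
  summable [set: T] f ->
  (\esum_(x in [set: T]) f^\+ x)%E \is a fin_num /\
  (\esum_(x in [set: T]) f^\- x)%E \is a fin_num.
Proof.
move=> sf; split; rewrite ge0_fin_numE ?esum_ge0//.
  have := summable_funepos sf; rewrite /summable.
  by under eq_esum => x _ do rewrite gee0_abs//.
have := summable_funeneg sf; rewrite /summable.
by under eq_esum => x _ do rewrite gee0_abs//.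
Qed.

Lemma le_real_sum (T : discreteTopologicalType) (f g : T -> R) :
  summable [set: T] (EFin \o f) -> summable [set: T] (EFin \o g) ->
  (forall x, f x <= g x) -> real_sum f <= real_sum g.
Proof.
move=> /summable_pos_neg_fin_num[f1 f2] /summable_pos_neg_fin_num[g1 g2] fg.
rewrite /real_sum fine_le ?fin_numB ?f1 ?f2 ?g1 ?g2//.
apply: leeB; apply: le_esum => x _.
  rewrite !funeposE ge_max !le_max lexx orbT andbT lee_fin.
  by rewrite fg.
rewrite !funenegE ge_max !le_max lexx orbT andbT leeN2 lee_fin.
by rewrite fg.
Qed.

Lemma real_sumN (T : discreteTopologicalType) (f : T -> R) :
  summable [set: T] (EFin \o f) -> real_sum (fun x => - f x) = - real_sum f.
Proof.
move=> /summable_pos_neg_fin_num[f1 f2]; rewrite /real_sum.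
have -> : EFin \o (fun x => - f x) = (\- (EFin \o f))%E by [].
by rewrite funeposN funenegN -fineN fin_num_oppeB// addeC.
Qed.

End EsumComplements.

(** * Graphs and the formal Laplacian *)

Section GraphCalculus.
Context {R : realType} {X : discreteTopologicalType}.
Implicit Types (b : X -> X -> R) (m V f g c : X -> R) (x y : X) (r : R).

(** Extended-valued, so that an inequality [neighbor_sum b f x <= r%:E] also
    records that [f], if nonnegative, has a finite sum at [x]. *)
Definition neighbor_sum b f x : \bar R :=
  (\esum_(y in [set: X]) (b x y * f y)%:E)%E.

Definition degree b x : R := fine (neighbor_sum b (fun=> 1) x).

Lemma connected_ind b (P : X -> Prop) x : connected_graph b -> P x ->
  (forall y z, adj b y z -> P y -> P z) -> forall y, P y.
Proof.
move=> conn Px step y; have [p + <-] := conn x y.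
elim: p x Px => [//|z p IH] x Px /= /andP[xz]; apply: IH.
exact: step xz Px.
Qed.

Lemma exists_neighbor b x : connected_graph b -> infinite_set [set: X] ->
  exists y, adj b x y.
Proof.
move=> conn Xinf.
have [z zx] : exists z, z != x.
  apply: contrapT => /forallNP Xx; apply: Xinf.
  apply: (@sub_finite_set _ _ [set x]) => // z _ /=.
  by have /negP/negPn/eqP := Xx z.
have [[/=|y p /andP[xy _] _]] := conn x z; last by exists y.
by move=> _ xz; rewrite xz eqxx in zx.
Qed.

Section Graph.
Variables (b : X -> X -> R) (bG : is_graph b).

Let b_ge0 x y : 0 <= b x y. Proof. by case: bG. Qed.
Let b_sym x y : b x y = b y x. Proof. by case: bG. Qed.

Lemma adj_sym x y : adj b x y -> adj b y x.
Proof. by rewrite /adj b_sym. Qed.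

Lemma neighbor_sum_ge0 f x : (forall y, 0 <= f y) ->
  (0 <= neighbor_sum b f x)%E.
Proof. by move=> f0; apply: esum_ge0 => y _; rewrite lee_fin mulr_ge0. Qed.

Lemma le_neighbor_sum f g x : (forall y, f y <= g y) ->
  (neighbor_sum b f x <= neighbor_sum b g x)%E.
Proof.
by move=> fg; apply: le_esum => y _; rewrite lee_fin ler_wpM2l.
Qed.

Lemma neighbor_sumZ f r x : 0 <= r -> (forall y, 0 <= f y) ->
  (neighbor_sum b (fun y => r * f y)%R x = r%:E * neighbor_sum b f x)%E.
Proof.
move=> r0 f0; rewrite -esumZ//; last by move=> y; rewrite lee_fin mulr_ge0.
by apply: eq_esum => y _; rewrite -EFinM mulrCA.
Qed.

Lemma degreeE x : neighbor_sum b (fun=> 1) x = (degree b x)%:E.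
Proof.
rewrite fineK// ge0_fin_numE ?neighbor_sum_ge0//.
rewrite /neighbor_sum; under eq_esum => y _ do rewrite mulr1.
by case: bG.
Qed.

Lemma degree_ge0 x : 0 <= degree b x.
Proof. by rewrite -lee_fin -degreeE neighbor_sum_ge0. Qed.

Lemma neighbor_sum_cst r x : 0 <= r ->
  neighbor_sum b (fun=> r) x = (degree b x * r)%:E.
Proof.
move=> r0; rewrite mulrC EFinM -degreeE -neighbor_sumZ//.
by rewrite /neighbor_sum; under [in RHS]eq_esum => y _ do rewrite mulr1.
Qed.

Lemma le_neighbor_sum_term f x y : (forall y, 0 <= f y) ->
  ((b x y * f y)%:E <= neighbor_sum b f x)%E.
Proof.
move=> f0.
apply: (@le_esum_term _ _ (fun z => (b x z * f z)%:E)) => z.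
by rewrite lee_fin mulr_ge0.
Qed.

Lemma adj_degree_gt0 x y : adj b x y -> 0 < degree b x.
Proof.
move=> xy; apply: lt_le_trans xy _; rewrite -lee_fin -degreeE -[b x y]mulr1.
exact: (@le_neighbor_sum_term (fun=> 1)).
Qed.

Lemma in_domain_ge0P f : (forall y, 0 <= f y) ->
  in_domain b f <-> forall x, (neighbor_sum b f x < +oo)%E.
Proof.
move=> f0; have normE x : (\esum_(y in [set: X]) (b x y * `|f y|)%:E)%E
    = neighbor_sum b f x by apply: eq_esum => y _; rewrite ger0_norm.
by split=> + x => /(_ x); rewrite normE.
Qed.

Lemma neighbor_sum_fin_num f x : (forall y, 0 <= f y) -> in_domain b f ->
  neighbor_sum b f x \is a fin_num.
Proof.
move=> f0 /(in_domain_ge0P f0) domf.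
by rewrite ge0_fin_numE ?neighbor_sum_ge0.
Qed.

Lemma laplacian_ge0E m f x : m x != 0 -> (forall y, 0 <= f y) ->
  in_domain b f ->
  m x * laplacian b m f x = degree b x * f x - fine (neighbor_sum b f x).
Proof.
move=> m0 f0 domf; rewrite /laplacian mulrA divff// mul1r.
under [in LHS]eq_fun => y do rewrite mulrBr.
rewrite real_sumB; first 1 last.
- by move=> y; rewrite mulr_ge0.
- by move=> y; rewrite mulr_ge0.
- by rewrite -/(neighbor_sum b (fun=> f x) x) neighbor_sum_cst ?ltry.
- by have /(in_domain_ge0P f0) := domf; exact.
by rewrite -/(neighbor_sum b (fun=> f x) x) neighbor_sum_cst.
Qed.

(** The form in which super- and subharmonicity are used below: all terms are
    nonnegative, and the neighbour sum is monotone in [f], so that infima,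
    suprema and minima can be handled without cancellation. *)
Lemma schrodinger_ge_neighbor_sum m V f r x : 0 < m x ->
  (forall y, 0 <= f y) -> in_domain b f ->
  (r <= schrodinger b m V f x) =
  ((m x * r)%:E + neighbor_sum b f x
     <= ((degree b x + m x * V x) * f x)%:E)%E.
Proof.
move=> m0 f0 domf.
rewrite -[neighbor_sum _ _ _]fineK ?neighbor_sum_fin_num// -EFinD lee_fin.
rewrite -[LHS](ler_pM2l m0) /schrodinger mulrDr laplacian_ge0E ?gt_eqF//.
by rewrite mulrA [X in X <= _]mulrC; apply/idP/idP; lra.
Qed.

(** The strong minimum principle: if [f] vanishes at [y], then so does its
    neighbour sum, and the zero spreads through the connected graph. *)
Lemma superharmonic_gt0 c f x : connected_graph b -> (forall y, 0 <= f y) ->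
  (forall y, neighbor_sum b f y <= (c y * f y)%:E)%E ->
  0 < f x -> forall y, 0 < f y.
Proof.
move=> conn f0 sup fx; apply: (connected_ind conn fx) => y z yz fy.
have := le_trans (le_neighbor_sum_term z y f0) (sup z); rewrite lee_fin.
move=> le_z; rewrite lt0r f0 andbT; apply/eqP => fz; move: le_z.
by rewrite fz mulr0 leNgt mulr_gt0//; exact: adj_sym.
Qed.

End Graph.
End GraphCalculus.

(** * Green functions as least supersolutions *)

Section GreenFunction.
Context {R : realType} {X : discreteTopologicalType}.
Variables (m : X -> R) (b : X -> X -> R).
Hypotheses (m_gt0 : forall x, 0 < m x) (bG : is_graph b).
Hypotheses (conn : connected_graph b) (Xinf : infinite_set [set: X]).
Implicit Types (f g s phi : X -> R) (x y o : X) (a : R).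

Lemma indic1_ge0 o x : 0 <= \1_[set o] x :> R.
Proof. by rewrite indicE ler0n. Qed.

Lemma indic1_neq o x : x != o -> \1_[set o] x = 0 :> R.
Proof. by move=> xo; rewrite indicE memNset//= => /eqP; apply/negP. Qed.

Lemma indic1_eq o : \1_[set o] o = 1 :> R.
Proof. by rewrite indicE mem_set. Qed.

Lemma green_supersolutionP a o phi :
  green_supersolution b m a o phi <->
  (forall x, 0 < phi x) /\
  (forall x, (m x * \1_[set o] x)%:E + neighbor_sum b phi x
               <= ((degree b x + m x * a) * phi x)%:E)%E.
Proof.
split=> [[phi_gt0 dom sup]|[phi_gt0 sup]].
  split=> // x; rewrite -(schrodinger_ge_neighbor_sum bG)// => y.
  exact: ltW (phi_gt0 y).
have phi_ge0 y : 0 <= phi y by exact: ltW (phi_gt0 y).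
have dom : in_domain b phi.
  apply: (in_domain_ge0P b phi_ge0).2 => x; apply: le_lt_trans (ltry _).
  apply: le_trans (sup x); rewrite leeDr// lee_fin mulr_ge0 ?indic1_ge0//.
  exact: ltW.
by split=> // x; rewrite (schrodinger_ge_neighbor_sum bG).
Qed.

Lemma neighbor_sum_le_of_source o f x (r : R) :
  ((m x * \1_[set o] x)%:E + neighbor_sum b f x <= r%:E)%E ->
  (neighbor_sum b f x <= r%:E)%E.
Proof.
apply: le_trans; rewrite leeDr// lee_fin mulr_ge0 ?indic1_ge0//.
exact: ltW.
Qed.

(** At each point the minimum coincides with one of the two functions and lies
    below it elsewhere, which only lowers the neighbour sum.  The condition at
    [o] ensures that there it coincides with [phi], which carries the source. *)
Lemma green_supersolution_min a o phi s :
  green_supersolution b m a o phi -> (forall x, 0 < s x) ->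
  (forall x, neighbor_sum b s x <= ((degree b x + m x * a) * s x)%:E)%E ->
  phi o <= s o ->
  green_supersolution b m a o (fun x => Num.min (phi x) (s x)).
Proof.
move=> /green_supersolutionP[phi_gt0 phi_sup] s_gt0 s_sup phi_s.
apply/green_supersolutionP; split=> x; first by rewrite lt_min phi_gt0 s_gt0.
have [phi_le|s_lt] := leP (phi x) (s x).
  apply: le_trans (phi_sup x); apply: leeD2l; apply: le_neighbor_sum => // y.
  by rewrite ge_min lexx.
have xo : x != o by apply: contraTneq s_lt => ->; rewrite -leNgt.
rewrite indic1_neq// mulr0 add0e; apply: le_trans (s_sup x).
by apply: le_neighbor_sum => // y; rewrite ge_min lexx orbT.
Qed.

Lemma coef_gt0 a x : 0 < a -> 0 < degree b x + m x * a.
Proof. by move=> a0; rewrite ltr_wpDl ?degree_ge0 ?mulr_gt0. Qed.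

(** Perron's method.  The constant [1 / a] is a supersolution; the pointwise
    infimum [g] of all supersolutions is one too, because its neighbour sum
    lies below that of each competitor; and [g > 0] since the source makes it
    positive at [o]. *)
Lemma greenP a o : 0 < a -> is_green b m a o (green b m a o).
Proof.
move=> a0; rewrite /green; case: xgetP => [//|noG]; exfalso.
pose S := green_supersolution b m a o.
have S_ge0 phi y : S phi -> 0 <= phi y.
  by move=> /green_supersolutionP[phi_gt0 _]; exact: ltW.
have S_cst : S (fun=> a^-1).
  apply/green_supersolutionP; split=> x; first by rewrite invr_gt0.
  rewrite neighbor_sum_cst//; last by rewrite invr_ge0 ltW.
  rewrite -EFinD lee_fin mulrDl addrC lerD2l mulfK ?gt_eqF// ger_pMr//.
pose g x := inf [set phi x | phi in S].
have hl x : has_lbound [set phi x | phi in S].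
  by exists 0 => _ [phi Sphi <-]; exact: S_ge0.
have g_le phi x : S phi -> g x <= phi x.
  by move=> Sphi; apply: ge_inf => //; exists phi.
have g_ge0 x : 0 <= g x.
  by apply: lb_le_inf; [exists (a^-1), (fun=> a^-1)|
    move=> _ [phi Sphi <-]; exact: S_ge0].
have g_sup x : ((m x * \1_[set o] x)%:E + neighbor_sum b g x
               <= ((degree b x + m x * a) * g x)%:E)%E.
  have bound phi : S phi -> ((m x * \1_[set o] x)%:E + neighbor_sum b g x
               <= ((degree b x + m x * a) * phi x)%:E)%E.
    move=> Sphi; have /green_supersolutionP[_ /(_ x)] := Sphi.
    by apply: le_trans; apply: leeD2l; apply: le_neighbor_sum => // y; exact: g_le.
  have fin : neighbor_sum b g x \is a fin_num.
    rewrite ge0_fin_numE ?neighbor_sum_ge0//.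
    apply: le_lt_trans (ltry _); apply: (@neighbor_sum_le_of_source o).
    exact: bound S_cst.
  move: bound; rewrite -(fineK fin) -EFinD => bound; rewrite lee_fin [leRHS]mulrC.
  rewrite -ler_pdivrMr ?coef_gt0//; apply: lb_le_inf.
    by exists (a^-1), (fun=> a^-1).
  move=> _ [phi Sphi <-]; rewrite ler_pdivrMr ?coef_gt0// [leRHS]mulrC -lee_fin.
  exact: bound.
apply: (noG g); split; last by move=> phi Sphi x; exact: g_le.
apply/green_supersolutionP; split=> //.
apply: (@superharmonic_gt0 _ _ _ bG (fun x => degree b x + m x * a) _ o) => //.
  by move=> y; exact: neighbor_sum_le_of_source (g_sup y).
have := g_sup o; rewrite indic1_eq mulr1 => go.
have m_pos : (0 < (m o)%:E + neighbor_sum b g o)%E.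
  by apply: lt_le_trans (leeDl _ (neighbor_sum_ge0 bG _ _)) => //; rewrite lte_fin.
have := lt_le_trans m_pos go; by rewrite lte_fin pmulr_rgt0 ?coef_gt0.
Qed.

Lemma green_gt0 a o x : 0 < a -> 0 < green b m a o x.
Proof. by move=> /(greenP o)[[]]. Qed.

Lemma green_least a o phi x : 0 < a ->
  green_supersolution b m a o phi -> green b m a o x <= phi x.
Proof. by move=> a0 Sphi; exact: (greenP o a0).2. Qed.

(** Scale [s] so that it agrees with [G_a] at [o]; the minimum of the two is
    then a supersolution, hence equal to [G_a]. *)
Lemma green_le_superharmonic a o s x : 0 < a -> (forall y, 0 < s y) ->
  (forall y, neighbor_sum b s y <= ((degree b y + m y * a) * s y)%:E)%E ->
  green b m a o x <= green b m a o o / s o * s x.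
Proof.
move=> a0 s_gt0 s_sup; set r := _ / _.
have r_gt0 : 0 < r by rewrite divr_gt0 ?green_gt0.
have [Gsup _] := greenP o a0.
have := @green_supersolution_min a o _ (fun y => r * s y) Gsup.
have rs_gt0 y : 0 < r * s y by rewrite mulr_gt0.
have rs_sup y : (neighbor_sum b (fun z => r * s z)%R y
    <= ((degree b y + m y * a) * (r * s y))%:E)%E.
  rewrite neighbor_sumZ//; [|exact: ltW|by move=> z; exact: ltW].
  by rewrite mulrCA (EFinM r); apply: lee_wpmul2l => //; rewrite lee_fin ltW.
move=> /(_ rs_gt0 rs_sup); rewrite {1}/r divfK ?gt_eqF// lexx => /(_ isT).
move=> /(green_least x a0) /le_trans; apply.
by rewrite ge_min lexx orbT.
Qed.

Lemma green_le_pole a o x : 0 < a -> green b m a o x <= green b m a o o.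
Proof.
move=> a0; have := @green_le_superharmonic a o (fun=> 1) x a0 (fun=> ltr01).
rewrite divr1 mulr1; apply => y.
rewrite neighbor_sum_cst// !mulr1 lee_fin lerDl mulr_ge0// ltW//.
Qed.

(** Replacing each value of [G_a] by the value [T] that balances the equation
    at that point, given the old neighbours, lowers the function and keeps it a
    supersolution, so by minimality nothing changes. *)
Lemma green_subsolution a o x : 0 < a ->
  (((degree b x + m x * a) * green b m a o x)%:E
    <= (m x * \1_[set o] x)%:E + neighbor_sum b (green b m a o) x)%E.
Proof.
move=> a0; have [/green_supersolutionP[G_gt0 G_sup] _] := greenP o a0.
set G := green b m a o in G_gt0 G_sup *.
have G_ge0 y : 0 <= G y by exact: ltW.
have fin y : neighbor_sum b G y \is a fin_num.
  rewrite ge0_fin_numE ?neighbor_sum_ge0//.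
  by apply: le_lt_trans (ltry _); apply: (@neighbor_sum_le_of_source o).
pose T y := (m y * \1_[set o] y + fine (neighbor_sum b G y))
              / (degree b y + m y * a).
have TE y : ((degree b y + m y * a) * T y)%:E
    = ((m y * \1_[set o] y)%:E + neighbor_sum b G y)%E.
  by rewrite -[neighbor_sum _ _ _]fineK// -EFinD [X in X%:E]mulrC divfK// gt_eqF ?coef_gt0.
have TG y : T y <= G y.
  by rewrite -(ler_pM2l (coef_gt0 y a0)) -lee_fin TE.
have : green_supersolution b m a o T.
  apply/green_supersolutionP; split=> y; last first.
    by rewrite TE; apply: leeD2l; exact: le_neighbor_sum.
  rewrite divr_gt0 ?coef_gt0//.
  have [z yz] := exists_neighbor y conn Xinf.
  rewrite ltr_wpDl ?mulr_ge0 ?indic1_ge0//; first exact: ltW.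
  rewrite -lte_fin fineK//.
  by apply: lt_le_trans (le_neighbor_sum_term bG y z G_ge0); rewrite lte_fin mulr_gt0.
by move=> /(green_least x a0) GT; rewrite -TE lee_fin ler_pM2l ?coef_gt0.
Qed.

Lemma green_anti a a' o x : 0 < a -> a <= a' ->
  green b m a' o x <= green b m a o x.
Proof.
move=> a0 aa'; apply: green_least; first exact: lt_le_trans aa'.
have [/green_supersolutionP[G_gt0 G_sup] _] := greenP o a0.
apply/green_supersolutionP; split=> // y; apply: le_trans (G_sup y) _.
rewrite lee_fin ler_wpM2r ?lerD2l ?ler_wpM2l// ltW//.
Qed.

End GreenFunction.

(** * The Green formula and the energy form *)

Section Energy.
Context {R : realType} {X : discreteTopologicalType}.
Implicit Types (b k : X -> X -> R) (m V f g c psi phi : X -> R) (x y o : X).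

(** Expand the product and exchange the two ends of each edge.  The subtracted
    term is moved to the left so that all sums are of nonnegative terms and the
    identity holds in the extended reals. *)
Lemma green_identity k f psi :
  (forall x y, 0 <= k x y) -> (forall x y, k x y = k y x) ->
  (forall x, 0 <= f x) -> (forall x, 0 <= psi x) ->
  (forall x y, 0 <= (f x - f y) * (psi x - psi y)) ->
  (\esum_(p in [set: X * X])
      (k p.1 p.2 * ((f p.1 - f p.2) * (psi p.1 - psi p.2)))%:E
   + (\esum_(p in [set: X * X]) (k p.1 p.2 * (psi p.1 * f p.2))%:E) *+ 2
   = (\esum_(p in [set: X * X]) (k p.1 p.2 * (psi p.1 * f p.1))%:E) *+ 2)%E.
Proof.
move=> k0 ksym f0 psi0 mono.
have swap (F : X -> X -> R) :
    (\esum_(p in [set: X * X]) (k p.1 p.2 * F p.1 p.2)%:E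
     = \esum_(p in [set: X * X]) (k p.1 p.2 * F p.2 p.1)%:E)%E.
  rewrite (@esum_swap _ _ (fun x y => (k x y * F x y)%:E)).
  by apply: eq_esum => -[x y] _ /=; rewrite ksym.
have nneg (F : X -> X -> R) : (forall x y, 0 <= F x y) ->
    forall p : X * X, [set: X * X] p -> (0 <= (k p.1 p.2 * F p.1 p.2)%:E)%E.
  by move=> F0 p _; rewrite lee_fin mulr_ge0.
rewrite !mule2n {2}(swap (fun x y => psi x * f y)).
rewrite {2}(swap (fun x y => psi x * f x)).
rewrite -!esumD//=.
- by apply: eq_esum => -[x y] _ /=; rewrite -!EFinD; congr EFin; ring.
all: move=> [x y] _ /=; rewrite -?EFinD lee_fin ?addr_ge0//;
  by apply: mulr_ge0 => //; rewrite mulr_ge0.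
Qed.

Section Graph.
Variables (b : X -> X -> R) (bG : is_graph b).
Let b_ge0 x y : 0 <= b x y. Proof. by case: bG. Qed.
Let b_sym x y : b x y = b y x. Proof. by case: bG. Qed.

Lemma esum_edges_neighbor_sum c f :
  (forall x, 0 <= c x) -> (forall x, 0 <= f x) ->
  (\esum_(p in [set: X * X]) (b p.1 p.2 * (c p.1 * f p.2))%:E
   = \esum_(x in [set: X]) ((c x)%:E * neighbor_sum b f x))%E.
Proof.
move=> c0 f0.
rewrite (@esum_pair _ _ _ (fun x y => (b x y * (c x * f y))%:E)); last first.
  by move=> x y; rewrite lee_fin !mulr_ge0.
apply: eq_esum => x _; rewrite -neighbor_sumZ//.
Qed.

Lemma esum_edges_lty c f : (forall x, 0 <= c x) -> (forall x, 0 <= f x) ->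
  finitely_supported c -> in_domain b f ->
  (\esum_(p in [set: X * X]) (b p.1 p.2 * (c p.1 * f p.2))%:E < +oo)%E.
Proof.
move=> c0 f0 finc domf; rewrite esum_edges_neighbor_sum//.
apply: esum_lty_finite_support.
  apply: sub_finite_set finc => x /=.
  by apply: contra_neq => ->; rewrite mul0e.
move=> x; rewrite mule_ge0 ?lee_fin ?neighbor_sum_ge0//=.
rewrite lte_mul_pinfty ?lee_fin//.
exact: (in_domain_ge0P b f0).1.
Qed.

Lemma esum_edges_degree c f :
  (forall x, 0 <= c x) -> (forall x, 0 <= f x) ->
  (\esum_(p in [set: X * X]) (b p.1 p.2 * (c p.1 * f p.1))%:E
   = \esum_(x in [set: X]) ((c x)%:E * (degree b x * f x)%:E))%E.
Proof.
move=> c0 f0.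
have := @esum_edges_neighbor_sum (fun x => c x * f x) (fun=> 1).
under eq_esum => p _ do rewrite mulr1.
move=> ->//; last by move=> x; rewrite mulr_ge0.
apply: eq_esum => x _; rewrite degreeE// -!EFinM; congr EFin; ring.
Qed.

(** In [green_identity] the two sums without differences are compared vertex by
    vertex through [Delta f <= 1_o]; the finite support of [psi] allows
    cancelling them. *)
Lemma flux_energy_le m o f psi : (forall x, 0 < m x) ->
  (forall x, 0 <= f x) -> (forall x, 0 <= psi x) ->
  (forall x y, 0 <= (f x - f y) * (psi x - psi y)) ->
  finitely_supported psi -> in_domain b f ->
  (forall x, ((degree b x * f x)%:E
     <= (m x * \1_[set o] x)%:E + neighbor_sum b f x)%E) ->
  (\esum_(p in [set: X * X])
     (b p.1 p.2 * ((f p.1 - f p.2) * (psi p.1 - psi p.2)))%:E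
   <= (2 * (m o * psi o))%:E)%E.
Proof.
move=> m_gt0 f0 psi0 mono finpsi domf sub.
have := green_identity b_ge0 b_sym f0 psi0 mono.
rewrite esum_edges_degree//.
set B := esum _ _; set P := esum _ _; set D := esum _ _ => BPD.
have PE : P = (\esum_(x in [set: X]) ((psi x)%:E * neighbor_sum b f x))%E.
  exact: esum_edges_neighbor_sum.
have P_fin : P \is a fin_num.
  rewrite ge0_fin_numE ?esum_edges_lty//.
  by apply: esum_ge0 => p _; rewrite lee_fin !mulr_ge0.
have DP : (D <= (m o * psi o)%:E + P)%E.
  have -> : (m o * psi o)%:E
     = (\esum_(x in [set: X]) (psi x * (m x * \1_[set o] x))%:E)%E.
    have -> : (m o * psi o)%:E
       = (\esum_(x in [set o]) (psi x * (m x * \1_[set o] x))%:E)%E.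
      rewrite esum_set1 ?indic1_eq ?mulr1; first by congr EFin; rewrite mulrC.
      by rewrite lee_fin mulr_ge0// ltW.
    rewrite esum_mkcond; apply: eq_esum => x _; case: ifPn => //.
    by rewrite notin_setE => /eqP xo; rewrite indic1_neq// !mulr0.
  rewrite PE -esumD.
  - apply: le_esum => x _; rewrite (EFinM (psi x)) -ge0_muleDr ?neighbor_sum_ge0//.
      by apply: lee_wpmul2l; rewrite ?lee_fin.
    by rewrite lee_fin mulr_ge0 ?indic1_ge0// ltW.
  - by move=> x _; rewrite lee_fin !mulr_ge0 ?indic1_ge0// ltW.
  - by move=> x _; rewrite mule_ge0 ?lee_fin ?neighbor_sum_ge0.
have P2_fin : (P *+ 2)%E \is a fin_num by rewrite mule2n fin_numD P_fin.
rewrite -(leeD2rE _ _ P2_fin) BPD.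
apply: le_trans (leeD DP DP) _.
by rewrite mule2n addeACA -EFinD; apply: leeD => //; rewrite lee_fin; lra.
Qed.

(** Twice the energy at potential 0, before the passage to real numbers. *)
Definition dirichlet phi : \bar R :=
  (\esum_(p in [set: X * X]) (b p.1 p.2 * (phi p.1 - phi p.2) ^+ 2)%:E)%E.

Lemma dirichlet_edge phi x y :
  ((b x y * (phi x - phi y) ^+ 2)%:E <= dirichlet phi)%E.
Proof.
apply: (@le_esum_term _ _
  (fun p => (b p.1 p.2 * (phi p.1 - phi p.2) ^+ 2)%:E) (x, y)).
by move=> p; rewrite lee_fin mulr_ge0 ?sqr_ge0.
Qed.

(** The Hardy weight [W] gives the bound at a point where [W > 0]; each edge
    energy then carries it over to the adjacent vertices. *)
Lemma point_le_dirichlet m x : connected_graph b -> (forall y, 0 < m y) ->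
  subcritical b m (fun=> 0) ->
  exists2 C : R, 0 <= C & forall phi (r : R), finitely_supported phi ->
    (dirichlet phi <= r%:E)%E -> phi x ^+ 2 <= C * r.
Proof.
move=> conn m_gt0 [_ [W [W0 [z Wz]] hardy]].
pose P y := exists2 C : R, 0 <= C & forall phi (r : R), finitely_supported phi ->
    (dirichlet phi <= r%:E)%E -> phi y ^+ 2 <= C * r.
apply: (@connected_ind _ _ b P z) => //.
  have mWz : 0 < m z * W z by rewrite mulr_gt0// lt0r Wz W0.
  exists (m z * W z)^-1; first by rewrite invr_ge0 ltW.
  move=> phi r finphi phir.
  rewrite ler_pdivlMl//.
  have D_ge0 : (0 <= dirichlet phi)%E.
    by apply: esum_ge0 => p _; rewrite lee_fin mulr_ge0 ?sqr_ge0.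
  have r0 : 0 <= r by rewrite -lee_fin (le_trans D_ge0).
  have energy_le : energy b m (fun=> 0) phi <= r.
    rewrite /energy fsbig1 ?addr0; last by move=> y _; rewrite mulr0 mul0r.
    have : fine (dirichlet phi) <= r.
      rewrite -lee_fin fineK// ge0_fin_numE//.
      exact: le_lt_trans phir (ltry _).
    have : 0 <= fine (dirichlet phi) by rewrite fine_ge0.
    rewrite /dirichlet; lra.
  apply: le_trans energy_le; apply: le_trans (hardy _ finphi).
  have finE : finite_set ([set: X] `&`
      (fun y => m y * W y * phi y ^+ 2) @^-1` [set~ 0]).
    apply: sub_finite_set finphi => y [_] /= /eqP.
    by apply: contra_neq => ->; rewrite expr0n mulr0.
  have [->|phiz] := eqVneq (phi z) 0.
    rewrite expr0n mulr0; apply: sumr_ge0 => y _.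
    by apply: mulr_ge0; rewrite ?sqr_ge0//; apply: mulr_ge0; rewrite ?W0 ?ltW.
  have zE : ([set: X] `&` (fun y => m y * W y * phi y ^+ 2) @^-1` [set~ 0]) z.
    by split=> //=; apply/eqP; rewrite mulf_neq0 ?sqrf_eq0// gt_eqF.
  rewrite fsbig_supp (fsbigD1 z _ _ finE zE) /= lerDl; apply: sumr_ge0 => y _.
  by apply: mulr_ge0; rewrite ?sqr_ge0//; apply: mulr_ge0; rewrite ?W0 ?ltW.
move=> y y' yy' [C C0 HC].
exists (2 * C + 2 / b y y'); first by rewrite addr_ge0 ?mulr_ge0 ?invr_ge0.
move=> phi r finphi phir.
have := HC phi r finphi phir.
have := le_trans (dirichlet_edge phi y y') phir; rewrite lee_fin mulrC.
rewrite -ler_pdivlMr// => h1 h2.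
have -> : (2 * C + 2 / b y y') * r = 2 * (C * r) + 2 * (r / b y y') by ring.
(* With [d := phi y - phi y'], the square added here completes
   [phi y' ^+ 2 <= 2 * phi y ^+ 2 + 2 * d ^+ 2] to an equality. *)
have := sqr_ge0 (2 * phi y - phi y'); move: h1 h2; rewrite !expr2.
set t := r / _; lra.
Qed.

End Graph.
End Energy.

(** * Finiteness of the minimal Green function *)

Section MinimalGreenFunction.
Context {R : realType} {X : discreteTopologicalType}.
Variables (m : X -> R) (b : X -> X -> R).
Hypotheses (m_gt0 : forall x, 0 < m x) (bG : is_graph b).
Hypotheses (conn : connected_graph b) (Xinf : infinite_set [set: X]).
Hypothesis Delta_subcritical : subcritical b m (fun=> 0).
Variable o : X.
Implicit Types (f g : X -> R) (x y : X) (a : R).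

(** Subsolutions of [Delta f = 1_o] to which the energy inequality of a
    subcritical Laplacian applies directly, because of their finite support. *)
Definition finite_subsolution f : Prop :=
  [/\ forall x, 0 <= f x, finitely_supported f
    & forall x, ((degree b x * f x)%:E
        <= (m x * \1_[set o] x)%:E + neighbor_sum b f x)%E].

Let source_ge0 x : 0 <= m x * \1_[set o] x.
Proof. by rewrite mulr_ge0 ?indic1_ge0// ltW. Qed.

Let deg_gt0 x : 0 < degree b x.
Proof.
by have [y xy] := exists_neighbor x conn Xinf; exact: adj_degree_gt0 xy.
Qed.

Lemma finitely_supported_in_domain f : finitely_supported f -> in_domain b f.
Proof.
move=> finf x; apply: esum_lty_finite_support => [|y]; last first.
  by rewrite ltry andbT lee_fin mulr_ge0//; case: bG.
apply: sub_finite_set finf => y /= ne; apply/eqP => fy.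
by rewrite fy normr0 mulr0 eqxx in ne.
Qed.

Lemma finite_subsolution0 : finite_subsolution (fun=> 0).
Proof.
split=> // [|x].
  rewrite /finitely_supported (_ : [set _ | _] = set0)//.
  by apply/seteqP; split=> // x /=; rewrite eqxx.
by rewrite mulr0 adde_ge0 ?lee_fin// neighbor_sum_ge0.
Qed.

(** Testing the subsolution inequality with [f] itself bounds its energy by a
    multiple of [f o], while [f o ^+ 2] is at most a multiple of the energy. *)
Lemma finite_subsolution_bound x :
  exists K : R, forall f, finite_subsolution f -> f x <= K.
Proof.
have [Co Co0 HCo] := point_le_dirichlet bG o conn m_gt0 Delta_subcritical.
have [Cx Cx0 HCx] := point_le_dirichlet bG x conn m_gt0 Delta_subcritical.
exists (1 + Cx * (2 * (m o * (Co * (2 * m o))))) => f [f0 finf subf].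
have domf := finitely_supported_in_domain finf.
have energyf : (dirichlet b f <= (2 * (m o * f o))%:E)%E.
  have := @flux_energy_le _ _ _ bG _ o _ _ m_gt0 f0 f0 _ finf domf subf.
  rewrite /dirichlet.
  under [in X in _ -> X]eq_esum => p _ do rewrite expr2.
  by apply => y z; rewrite -expr2 sqr_ge0.
have fo : f o <= Co * (2 * m o).
  have := HCo _ _ finf energyf.
  have [->|fo_neq0] := eqVneq (f o) 0.
    by move=> _; rewrite !mulr_ge0// ltW.
  have fo_gt0 : 0 < f o by rewrite lt0r fo_neq0 f0.
  by move=> fo2; rewrite -(ler_pM2r fo_gt0) -!mulrA -expr2.
have := HCx _ _ finf energyf.
have : Cx * (2 * (m o * f o)) <= Cx * (2 * (m o * (Co * (2 * m o)))).
  by rewrite !ler_wpM2l// ltW.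
(* [f x <= 1 + f x ^+ 2] replaces taking a square root. *)
have := sqr_ge0 (f x - 2^-1); rewrite !expr2; lra.
Qed.

Lemma finite_subsolution_max f g :
  finite_subsolution f -> finite_subsolution g ->
  finite_subsolution (fun x => Num.max (f x) (g x)).
Proof.
move=> [f0 finf subf] [g0 fing subg]; split=> [x||x].
- by rewrite le_max f0.
- apply: sub_finite_set (_ : finite_set
    ([set x | f x != 0] `|` [set x | g x != 0])); last by rewrite finite_setU.
  move=> x /=; apply: contra_neqP => /not_orP[/negP/negPn/eqP-> /negP/negPn/eqP->].
  by rewrite maxxx.
- have [fg|gf] := leP (f x) (g x).
    apply: le_trans (subg x) _; apply: leeD2l; apply: le_neighbor_sum => // y.
    by rewrite le_max lexx orbT.
  apply: le_trans (subf x) _; apply: leeD2l; apply: le_neighbor_sum => // y.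
  by rewrite le_max lexx.
Qed.

Definition subsolution_sup x : R := sup [set f x | f in finite_subsolution].

Lemma subsolution_sup_ge f x : finite_subsolution f -> f x <= subsolution_sup x.
Proof.
move=> Sf; apply: ub_le_sup; last by exists f.
by have [K HK] := finite_subsolution_bound x; exists K => _ [g Sg <-]; exact: HK.
Qed.

Lemma subsolution_sup_le x (r : R) :
  (forall f, finite_subsolution f -> f x <= r) -> subsolution_sup x <= r.
Proof.
move=> Hr; apply: ge_sup; last by move=> _ [f Sf <-]; exact: Hr.
by exists 0, (fun=> 0) => //; exact: finite_subsolution0.
Qed.

Lemma subsolution_sup_ge0 x : 0 <= subsolution_sup x.
Proof. exact: subsolution_sup_ge finite_subsolution0. Qed.

(** Raising [f] at the single point [x] to the value [t] that balances the
    equation there gives another finitely supported subsolution. *)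
Lemma subsolution_lift f x : finite_subsolution f ->
  ((m x * \1_[set o] x)%:E + neighbor_sum b f x
     <= (degree b x * subsolution_sup x)%:E)%E.
Proof.
move=> Sf; have [f0 finf subf] := Sf.
have fin : neighbor_sum b f x \is a fin_num.
  exact: neighbor_sum_fin_num bG _ _ f0 (finitely_supported_in_domain finf).
pose t := (m x * \1_[set o] x + fine (neighbor_sum b f x)) / degree b x.
have tE : (degree b x * t)%:E = ((m x * \1_[set o] x)%:E + neighbor_sum b f x)%E.
  by rewrite -[neighbor_sum _ _ _]fineK// -EFinD [X in X%:E]mulrC divfK// gt_eqF.
rewrite -tE lee_fin ler_pM2l//.
pose f' y := if y == x then t else f y.
have ff' y : f y <= f' y.
  rewrite /f'; case: eqP => // ->.
  by rewrite -(ler_pM2l (deg_gt0 x)) -lee_fin tE.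
have := @subsolution_sup_ge f' x; rewrite {2}/f' eqxx; apply; split.
- by move=> y; exact: le_trans (ff' y).
- apply: sub_finite_set (_ : finite_set
    ([set x] `|` [set x | f x != 0])); last by rewrite finite_setU.
  move=> y; rewrite /= /f'; have [->|yx] := eqVneq y x; first by left.
  by right.
- move=> y; have mono := le_neighbor_sum bG y ff'.
  apply: le_trans (leeD2l _ mono); rewrite /f'; case: eqP => [->|_//].
  by rewrite tE.
Qed.

(** Interchange of a supremum with a finite sum.  The family is directed by
    [finite_subsolution_max], so the vertices of [t] can be moved to [s] one by
    one, passing to the supremum at a single vertex each time. *)
Lemma subsolution_sup_sum x (s t : seq X) f : finite_subsolution f ->
  uniq (s ++ t) ->
  m x * \1_[set o] x + \sum_(y <- s) b x y * subsolution_sup y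
    + \sum_(y <- t) b x y * f y <= degree b x * subsolution_sup x.
Proof.
have b_ge0 y : 0 <= b x y by case: bG.
elim: s t f => [|z s IH] t f Sf.
  move=> /= ut; rewrite big_nil addr0.
  have := subsolution_lift x Sf; rewrite -lee_fin; apply: le_trans.
  rewrite EFinD; apply: leeD2l; apply: esum_ge; exists [set` t].
    by split=> //; exact: finite_seq.
  by rewrite -fsbig_seq// sumEFin.
move=> u; have u' : uniq (s ++ z :: t) by rewrite -cat1s uniq_catCA.
rewrite big_cons; set A := _ * _; set B := \sum_(y <- s) _; set C := \sum_(y <- t) _.
suff : b x z * subsolution_sup z
    <= degree b x * subsolution_sup x - A - B - C by lra.
have le_g g : finite_subsolution g ->
    b x z * g z <= degree b x * subsolution_sup x - A - B - C.
  move=> Sg; have := IH (z :: t) _ (finite_subsolution_max Sf Sg) u'.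
  rewrite big_cons.
  have : C <= \sum_(y <- t) b x y * Num.max (f y) (g y).
    by apply: ler_sum => y _; rewrite ler_wpM2l// le_max lexx.
  have : b x z * g z <= b x z * Num.max (f z) (g z).
    by rewrite ler_wpM2l// le_max lexx orbT.
  rewrite -/A -/B; lra.
have [bz|bz] := eqVneq (b x z) 0.
  by have := le_g _ Sf; rewrite bz !mul0r.
have bz0 : 0 < b x z by rewrite lt0r bz b_ge0.
rewrite mulrC -ler_pdivlMr//; apply: subsolution_sup_le => g Sg.
by rewrite ler_pdivlMr// mulrC; exact: le_g.
Qed.

Lemma subsolution_sup_super x :
  ((m x * \1_[set o] x)%:E + neighbor_sum b subsolution_sup x
     <= (degree b x * subsolution_sup x)%:E)%E.
Proof.
rewrite addeC -leeBrDr//; apply: ge_ereal_sup => _ [A [finA _] <-].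
rewrite fsbig_finite// sumEFin -EFinB lee_fin lerBrDr addrC.
have := @subsolution_sup_sum x (finmap.enum_fset (fset_set A)) [::] _ finite_subsolution0.
by rewrite big_nil addr0 cats0; apply; exact: finmap.fset_uniq.
Qed.

(** The common upper bound of all [G_a], independent of [a]. *)
Lemma subsolution_sup_green a : 0 <= a ->
  green_supersolution b m a o subsolution_sup.
Proof.
move=> a0.
apply/(green_supersolutionP m_gt0 bG); split=> x; last first.
  apply: le_trans (subsolution_sup_super x) _; rewrite lee_fin.
  by rewrite ler_wpM2r ?subsolution_sup_ge0// lerDl mulr_ge0// ltW.
apply: (@superharmonic_gt0 _ _ _ bG (degree b) _ o) => //.
- exact: subsolution_sup_ge0.
- move=> y; apply: (@neighbor_sum_le_of_source _ _ _ _ m_gt0 o).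
  exact: subsolution_sup_super.
- have := subsolution_sup_super o; rewrite indic1_eq mulr1 => ho.
  have m_pos : (0 < (m o)%:E + neighbor_sum b subsolution_sup o)%E.
    apply: lt_le_trans (leeDl _ (neighbor_sum_ge0 bG _ _)).
      by rewrite lte_fin.
    exact: subsolution_sup_ge0.
  by have := lt_le_trans m_pos ho; rewrite lte_fin pmulr_rgt0.
Qed.

(** As [a] decreases to 0 the functions [G_a] increase, so the limit is the
    supremum, which is finite by [subsolution_sup_green]. *)
Lemma green0_sup x :
  (forall a, 0 < a -> green b m a o x <= green0 b m o x) /\
  (forall r : R, (forall a, 0 < a -> green b m a o x <= r) ->
    green0 b m o x <= r).
Proof.
pose E := (green b m ^~ o)^~ x @` [set` `]0, +oo[ : interval R].
have E_ub : has_ubound E.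
  exists (subsolution_sup x) => _ [a /= + <-]; rewrite in_itv/= andbT => a0.
  by apply: green_least => //; apply: subsolution_sup_green; exact: ltW.
have cvgE : green b m a o x @[a --> 0^'+] --> sup E.
  apply: nonincreasing_at_right_cvgr => //.
  move=> a a'; rewrite !in_itv/= !andbT => a0 a'0 aa'.
  exact: green_anti.
have -> : green0 b m o x = sup E by exact: cvg_lim cvgE.
split=> [a a0|r Hr].
  by apply: ub_le_sup => //; exists a => //=; rewrite in_itv/= a0.
apply: ge_sup; first by exists (green b m 1 o x), 1 => //=; rewrite in_itv/= ltr01.
by move=> _ [a /= + <-]; rewrite in_itv/= andbT => /Hr.
Qed.

Lemma green0_gt0 x : 0 < green0 b m o x.
Proof.
have [/(_ 1 ltr01) G1 _] := green0_sup x.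
by apply: lt_le_trans G1; apply: green_gt0.
Qed.

Lemma green0_le_pole x : green0 b m o x <= green0 b m o o.
Proof.
have [_] := green0_sup x; apply => a a0.
apply: (@le_trans _ _ (green b m a o o)); first exact: green_le_pole.
by have [+ _] := green0_sup o; exact.
Qed.

Lemma green0_in_domain : in_domain b (green0 b m o).
Proof.
apply: (in_domain_ge0P b (fun x => ltW (green0_gt0 x))).2 => x.
apply: le_lt_trans (ltry (degree b x * green0 b m o o)).
rewrite -neighbor_sum_cst; [|by []|exact: ltW (green0_gt0 o)].
apply: le_neighbor_sum => // y; exact: green0_le_pole.
Qed.

Lemma green0_subsolution x :
  ((degree b x * green0 b m o x)%:E
    <= (m x * \1_[set o] x)%:E + neighbor_sum b (green0 b m o) x)%E.
Proof.
have G_ge0 y : 0 <= green0 b m o y by exact: ltW (green0_gt0 y).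
have fin := neighbor_sum_fin_num bG x G_ge0 green0_in_domain.
rewrite -(fineK fin) -EFinD lee_fin mulrC -ler_pdivlMr//.
have [_] := green0_sup x; apply => a a0.
rewrite ler_pdivlMr// mulrC -lee_fin EFinD fineK//.
have Ga := green_subsolution m_gt0 bG conn Xinf o x a0.
have deg_le : ((degree b x * green b m a o x)%:E
    <= ((degree b x + m x * a) * green b m a o x)%:E)%E.
  rewrite lee_fin ler_wpM2r ?lerDl ?mulr_ge0// ltW//.
  exact: green_gt0.
apply: le_trans deg_le _; apply: le_trans Ga _; apply: leeD2l.
apply: le_neighbor_sum => // y; have [+ _] := green0_sup y; exact.
Qed.

End MinimalGreenFunction.

(** * Logarithmic cutoffs of the minimal Green function *)

Section LogarithmicCutoff.
Context {R : realType}.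
Implicit Types (s t : R).

Definition clamp t : R := Num.max 0 (Num.min 1 t).

Lemma clamp_ge0 t : 0 <= clamp t.
Proof. by rewrite le_max lexx. Qed.

Lemma clamp_le1 t : clamp t <= 1.
Proof. by rewrite ge_max ler01 ge_min lexx. Qed.

Lemma clamp_eq1 t : 1 <= t -> clamp t = 1.
Proof. by move=> t1; rewrite /clamp (min_idPl t1); apply/max_idPr. Qed.

Lemma clamp_neq0 t : clamp t != 0 -> 0 < t.
Proof.
apply: contraNT; rewrite -leNgt => t0.
by rewrite /clamp (max_idPl _)// ge_min t0 orbT.
Qed.

Lemma clamp_contract s t : s <= t -> 0 <= clamp t - clamp s <= t - s.
Proof.
move=> st; rewrite /clamp; case: (leP 1 s); case: (leP 1 t) => ? ?;
  rewrite ?(max_r ler01);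
  case: (leP 0 s) => ?; case: (leP 0 t) => ?; apply/andP; split; lra.
Qed.

(** Apply [ln r <= r - 1] to the quotient of the square roots; the optimal
    constant would be 1. *)
Lemma geometric_le_logarithmic_mean s t : 0 < s -> s <= t ->
  Num.sqrt s * Num.sqrt t * (ln t - ln s) <= 2 * (t - s).
Proof.
move=> s0 st; have t0 := lt_le_trans s0 st.
set p := Num.sqrt s; set q := Num.sqrt t.
have p0 : 0 < p by rewrite sqrtr_gt0.
have q0 : 0 < q by rewrite sqrtr_gt0.
have pE : s = p * p by rewrite -expr2 sqr_sqrtr// ltW.
have qE : t = q * q by rewrite -expr2 sqr_sqrtr// ltW.
have pq : p <= q by rewrite ler_wsqrtr.
have lnqp : ln q - ln p <= q / p - 1.
  rewrite -ln_div ?posrE//.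
  have := @le_ln1Dx _ (q / p - 1); rewrite [1 + _]addrC subrK; apply.
  by have : 0 < q / p := divr_gt0 q0 p0; lra.
rewrite qE pE !lnM ?posrE//.
have : p * (ln q - ln p) <= q - p.
  have := ler_wpM2l (ltW p0) lnqp.
  by rewrite [p * (_ - 1)]mulrBr mulr1 mulrCA divff ?gt_eqF// mulr1.
move/(ler_wpM2l (ltW q0)).
have : 0 <= (q - p) * (q - p) by rewrite mulr_ge0// subr_ge0.
have : 0 <= p * (q - p) by rewrite mulr_ge0 ?subr_ge0// ltW.
nra.
Qed.

End LogarithmicCutoff.

Section NullSequence.
Context {R : realType} {X : discreteTopologicalType}.
Variables (m : X -> R) (b : X -> X -> R) (o : X) (G : X -> R) (M : R).
Hypotheses (m_gt0 : forall x, 0 < m x) (bG : is_graph b).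
Hypotheses (G_gt0 : forall x, 0 < G x) (G_le : forall x, G x <= M).
Hypotheses (G_proper : proper_fun G) (G_domain : in_domain b G).
Hypothesis G_sub : forall x, ((degree b x * G x)%:E
    <= (m x * \1_[set o] x)%:E + neighbor_sum b G x)%E.
Implicit Types (x y : X) (n : nat).

Definition cutoff n x : R := clamp (2 + ln (G x) / n.+1%:R).

(** The support lies where [G] is between [exp (- 2 (n + 1))] and its upper
    bound, a compact interval of positive numbers. *)
Lemma cutoff_finitely_supported n : finitely_supported (cutoff n).
Proof.
have N0 : (0 : R) < n.+1%:R by rewrite ltr0n.
pose e : R := expR (- 2 * n.+1%:R).
have := G_proper (@segment_compact R e M).
have e_pos : `[e, M]%classic `<=` [set r | 0 < r].
  by move=> r /=; rewrite in_itv/= => /andP[+ _]; apply: lt_le_trans; exact: expR_gt0.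
move=> /(_ e_pos); apply: sub_finite_set => x /=.
move=> /clamp_neq0 pos; rewrite in_itv/= G_le andbT.
rewrite -[G x]lnK ?posrE// ler_expR mulNr lerNl.
have : 0 < (2 + ln (G x) / n.+1%:R) * n.+1%:R by rewrite mulr_gt0.
rewrite mulrDl divfK ?gt_eqF//; lra.
Qed.

Lemma cutoff_eventually1 x : exists n0, forall n, (n0 <= n)%N -> cutoff n x = 1.
Proof.
exists (Num.bound `|ln (G x)|) => n n0n; apply: clamp_eq1.
have N0 : (0 : R) < n.+1%:R by rewrite ltr0n.
suff : -1 <= ln (G x) / n.+1%:R by set q := _ / _; lra.
rewrite ler_pdivlMr// mulN1r lerNl.
rewrite (le_trans (ler_norm _))// normrN.
by rewrite (le_trans (ltW (archi_boundP (normr_ge0 _))))// ler_nat leqW.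
Qed.

(** On an edge, one factor [cutoff n x - cutoff n y] is bounded by the
    difference of logarithms divided by [n + 1], the other is kept. *)
Lemma cutoff_edge n x y :
  0 <= (G x - G y) * (cutoff n x - cutoff n y) /\
  Num.sqrt (G x) * Num.sqrt (G y) * (cutoff n x - cutoff n y) ^+ 2
    <= 2 / n.+1%:R * ((G x - G y) * (cutoff n x - cutoff n y)).
Proof.
wlog Gyx : x y / G y <= G x => [hw|].
  have [/hw//|/ltW/hw[h1 h2]] := leP (G y) (G x).
  rewrite -(opprB (G y)) -(opprB (cutoff n y)) mulrNN sqrrN.
  by rewrite [_ * Num.sqrt (G y)]mulrC.
have N0 : (0 : R) < n.+1%:R by rewrite ltr0n.
have ln_le : ln (G y) <= ln (G x) by rewrite ler_ln ?posrE.
have : 2 + ln (G y) / n.+1%:R <= 2 + ln (G x) / n.+1%:R.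
  by rewrite lerD2l ler_pM2r ?invr_gt0.
move=> /clamp_contract; rewrite -/(cutoff n x) -/(cutoff n y).
set d := cutoff n x - cutoff n y; move=> /andP[d0 dle].
split; first by rewrite mulr_ge0// subr_ge0.
have lm := geometric_le_logarithmic_mean (G_gt0 y) Gyx.
have dle' : d <= (ln (G x) - ln (G y)) / n.+1%:R.
  by move: dle; rewrite mulrBl opprD addrACA subrr add0r.
have q0 : 0 <= Num.sqrt (G x) * Num.sqrt (G y) by rewrite mulr_ge0 ?sqrtr_ge0.
rewrite expr2 [leRHS]mulrA mulrA; apply: ler_wpM2r => //.
apply: le_trans (ler_wpM2l q0 dle') _.
rewrite mulrA [leRHS]mulrAC ler_pM2r ?invr_gt0//.
by rewrite [Num.sqrt (G x) * _]mulrC.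
Qed.

Lemma cutoff_energy n :
  (\esum_(p in [set: X * X]) (b p.1 p.2 *
      (Num.sqrt (G p.1) * Num.sqrt (G p.2)
         * (cutoff n p.1 - cutoff n p.2) ^+ 2))%:E
   <= (4 * m o / n.+1%:R)%:E)%E.
Proof.
have b_ge0 x y : 0 <= b x y by case: bG.
have N0 : (0 : R) < n.+1%:R by rewrite ltr0n.
have flux := @flux_energy_le _ _ b bG m o G (cutoff n) m_gt0
   (fun x => ltW (G_gt0 x)) (fun x => clamp_ge0 _)
   (fun x y => (cutoff_edge n x y).1) (cutoff_finitely_supported n)
   G_domain G_sub.
apply: (@le_trans _ _ ((2 / n.+1%:R)%:E * (2 * (m o * cutoff n o))%:E)%E).
  apply: le_trans (_ : _ <= (2 / n.+1%:R)%:E * (\esum_(p in [set: X * X])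
    (b p.1 p.2 * ((G p.1 - G p.2) * (cutoff n p.1 - cutoff n p.2)))%:E))%E _.
    rewrite -esumZ; first last.
    - by move=> p; rewrite lee_fin; apply: mulr_ge0 => //; exact: (cutoff_edge n _ _).1.
    - by rewrite divr_ge0// ltW.
    apply: le_esum => p _; rewrite -EFinM lee_fin [leRHS]mulrCA ler_wpM2l//.
    exact: (cutoff_edge n _ _).2.
  by apply: lee_wpmul2l => //; rewrite lee_fin divr_ge0// ltW.
rewrite -EFinM lee_fin mulrAC ler_pM2r ?invr_gt0// mulrA.
have := clamp_le1 (2 + ln (G o) / n.+1%:R); rewrite -/(cutoff n o) => c1.
have := ler_wpM2l (ltW (m_gt0 o)) c1; lra.
Qed.

End NullSequence.

(** * The Liouville comparison argument *)

Section LiouvilleComparison.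
Context {R : realType} {X : discreteTopologicalType}.
Variables (b : X -> X -> R) (bG : is_graph b).
Let b_ge0 x y : 0 <= b x y. Proof. by case: bG. Qed.
Let b_sym x y : b x y = b y x. Proof. by case: bG. Qed.
Variables (c v w : X -> R).
Hypotheses (v_gt0 : forall x, 0 < v x) (w_ge0 : forall x, 0 <= w x).

Hypothesis v_super :
  forall x, (neighbor_sum b v x <= (c x * v x)%:E)%E.
Hypothesis w_sub :
  forall x, 0 < w x -> ((c x * w x)%:E <= neighbor_sum b w x)%E.
Implicit Types (psi : X -> R) (x y : X).

(** By [green_identity], each side is twice a difference of two sums.  The
    subtracted sums agree since [eta * v = w * psi], and the others are
    compared vertex by vertex: with [f := w * psi], super- and subharmonicity
    bound them from both sides by the sum of [c * f ^+ 2]. *)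
Lemma ground_state_comparison eta psi : (forall x, 0 <= psi x) ->
  finitely_supported psi -> (forall x, eta x * v x = w x * psi x) ->
  (\esum_(p in [set: X * X])
      (b p.1 p.2 * v p.1 * v p.2 * ((eta p.1 - eta p.2) * (eta p.1 - eta p.2)))%:E
   <= \esum_(p in [set: X * X])
      (b p.1 p.2 * w p.1 * w p.2 * ((psi p.1 - psi p.2) * (psi p.1 - psi p.2)))%:E)%E.
Proof.
move=> psi0 finpsi etav.
have v_ge0 x : 0 <= v x by exact: ltW.
have eta0 x : 0 <= eta x by rewrite -(pmulr_lge0 _ (v_gt0 x)) etav mulr_ge0.
have sq_ge0 (f : X -> R) x y : 0 <= (f x - f y) * (f x - f y).
  by rewrite -expr2 sqr_ge0.
have ker (h : X -> R) : (forall x, 0 <= h x) ->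
    (forall x y, 0 <= b x y * h x * h y) /\
    (forall x y, b x y * h x * h y = b y x * h y * h x).
  by move=> h0; split=> x y; [rewrite !mulr_ge0|rewrite b_sym mulrAC].
have [kv0 kvs] := ker v v_ge0; have [kw0 kws] := ker w w_ge0.
have := green_identity kv0 kvs eta0 eta0 (sq_ge0 eta).
have := green_identity kw0 kws psi0 psi0 (sq_ge0 psi).
set Aw := esum _ _; set Pw := esum _ _; set Dw := esum _ _ => idw.
set Av := esum _ _; set Pv := esum _ _; set Dv := esum _ _ => idv.
pose f x := w x * psi x.
have f0 x : 0 <= f x by rewrite mulr_ge0.
have finf : finitely_supported f.
  apply: sub_finite_set finpsi => x /= fx; apply/eqP => psix.
  by rewrite /f psix mulr0 eqxx in fx.
have PwE : Pw = (\esum_(p in [set: X * X]) (b p.1 p.2 * (f p.1 * f p.2))%:E)%E.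
  by apply: eq_esum => p _; congr EFin; rewrite /f; ring.
have PvE : Pv = Pw.
  rewrite PwE; apply: eq_esum => p _; congr EFin.
  by rewrite /f -!etav; ring.
have P_fin : Pw \is a fin_num.
  rewrite ge0_fin_numE; last first.
    by apply: esum_ge0 => p _; rewrite lee_fin !mulr_ge0.
  rewrite PwE; apply: esum_edges_lty => //.
  exact: finitely_supported_in_domain.
have DvE : Dv = (\esum_(x in [set: X])
    ((eta x ^+ 2 * v x)%:E * neighbor_sum b v x))%E.
  rewrite -(esum_edges_neighbor_sum bG)//; last by move=> x; rewrite mulr_ge0 ?sqr_ge0.
  by apply: eq_esum => p _; congr EFin; ring.
have DwE : Dw = (\esum_(x in [set: X])
    ((psi x ^+ 2 * w x)%:E * neighbor_sum b w x))%E.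
  rewrite -(esum_edges_neighbor_sum bG)//; last by move=> x; rewrite mulr_ge0 ?sqr_ge0.
  by apply: eq_esum => p _; congr EFin; ring.
have DvDw : (Dv <= Dw)%E.
  rewrite DvE DwE; apply: le_esum => x _.
  have [wx|wx] := eqVneq (w x) 0.
    have -> : eta x = 0.
      by apply/eqP; rewrite -(mulIr_eq0 _ (mulIf (lt0r_neq0 (v_gt0 x)))) etav wx mul0r.
    by rewrite wx expr0n/= mul0r mulr0 !mul0e.
  have wx0 : 0 < w x by rewrite lt0r wx w_ge0.
  apply: (@le_trans _ _ ((eta x ^+ 2 * v x)%:E * (c x * v x)%:E)%E).
    by apply: lee_wpmul2l => //; rewrite lee_fin mulr_ge0 ?sqr_ge0.
  have -> : ((eta x ^+ 2 * v x)%:E * (c x * v x)%:E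
      = (psi x ^+ 2 * w x)%:E * (c x * w x)%:E)%E.
    rewrite -!EFinM; congr EFin.
    have -> : eta x ^+ 2 * v x * (c x * v x) = c x * (eta x * v x) ^+ 2 by ring.
    by rewrite etav; ring.
  apply: lee_wpmul2l; last exact: w_sub.
  by rewrite lee_fin mulr_ge0 ?sqr_ge0.
have P2_fin : (Pw *+ 2)%E \is a fin_num by rewrite mule2n fin_numD P_fin.
rewrite -(leeD2rE _ _ P2_fin) idw -{1}PvE idv !mule2n.
exact: leeD.
Qed.

(** On a fixed edge [psi n] is eventually 1 at both ends, so the difference of
    [w / v] across it does not depend on [n], whereas its energy is at most a
    multiple of [1 / (n + 1)]. *)
Lemma ratio_constant (g : X -> R) (psi : nat -> X -> R) (K L : R) :
  connected_graph b ->
  (forall x, 0 <= g x) -> (forall x, w x <= K * g x) ->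
  (forall n x, 0 <= psi n x) -> (forall n, finitely_supported (psi n)) ->
  (forall x, exists n0, forall n, (n0 <= n)%N -> psi n x = 1) ->
  (forall n, (\esum_(p in [set: X * X]) (b p.1 p.2 *
      (g p.1 * g p.2 * (psi n p.1 - psi n p.2) ^+ 2))%:E
     <= (L / n.+1%:R)%:E)%E) ->
  forall x y, w x / v x = w y / v y.
Proof.
move=> conn g0 w_le psi0 finpsi psi1 null x.
apply: (connected_ind conn) => // y z yz ->.
have [n1 Hn1] := psi1 y; have [n2 Hn2] := psi1 z.
set d := w y / v y - w z / v z.
have kyz : 0 < b y z * v y * v z by rewrite !mulr_gt0.
have key n : (maxn n1 n2 <= n)%N ->
    n.+1%:R * (b y z * v y * v z * (d * d)) <= K * K * L.
  rewrite geq_max => /andP[n1n n2n].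
  have N0 : (0 : R) < n.+1%:R by rewrite ltr0n.
  rewrite mulrC -ler_pdivlMr// -[leRHS]mulrA -lee_fin (EFinM (K * K)).
  apply: le_trans (lee_wpmul2l _ (null n)); last by rewrite lee_fin -expr2 sqr_ge0.
  rewrite -esumZ; [|by rewrite -expr2 sqr_ge0|]; last first.
    by move=> p; rewrite lee_fin; apply: mulr_ge0 => //; apply: mulr_ge0;
      rewrite ?sqr_ge0// mulr_ge0.
  pose eta t := w t * psi n t / v t.
  have etav t : eta t * v t = w t * psi n t by rewrite divfK ?gt_eqF.
  apply: le_trans (_ : _ <= \esum_(p in [set: X * X])
      (b p.1 p.2 * v p.1 * v p.2 * ((eta p.1 - eta p.2) * (eta p.1 - eta p.2)))%:E)%E _.
    apply: le_trans (@le_esum_term _ _ (fun p => (b p.1 p.2 * v p.1 * v p.2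
      * ((eta p.1 - eta p.2) * (eta p.1 - eta p.2)))%:E) (y, z) _) => /=.
      by rewrite /eta Hn1// Hn2// !mulr1.
    move=> p; rewrite lee_fin; apply: mulr_ge0; last by rewrite -expr2 sqr_ge0.
    by rewrite !mulr_ge0// ltW.
  apply: le_trans (ground_state_comparison (psi0 n) (finpsi n) etav) _.
  apply: le_esum => -[s t] _ /=; rewrite -EFinM lee_fin -expr2.
  have -> : K * K * (b s t * (g s * g t * (psi n s - psi n t) ^+ 2))
    = b s t * ((K * g s) * (K * g t)) * (psi n s - psi n t) ^+ 2 by ring.
  rewrite ler_wpM2r ?sqr_ge0// -mulrA ler_wpM2l// ler_pM//.
apply/eqP; rewrite -subr_eq0 -/d; apply: contraT => d0.
set k := b y z * v y * v z * (d * d) in key.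
have k0 : 0 < k by rewrite mulr_gt0// -expr2 exprn_even_gt0.
pose n := maxn (maxn n1 n2) (Num.bound (K * K * L / k)).
have := key n (leq_maxl _ _); rewrite -ler_pdivlMr// leNgt => /negP[].
have [neg|pos] := ltP (K * K * L / k) 0.
  exact: lt_le_trans neg (ler0n _ _).
apply: lt_le_trans (archi_boundP pos) _.
by rewrite ler_nat leqW// leq_maxr.
Qed.

End LiouvilleComparison.

(** * Behaviour at infinity *)

Section AtInfinity.
Context {R : realType} {X : discreteTopologicalType}.
Implicit Types (u g : X -> R).

(** The bound near infinity extends to all of [X] since a positive [g] is
    bounded below on the finite exceptional set. *)
Lemma in_bigO_bound u g : (forall x, 0 < g x) -> in_bigO u g ->
  exists K : R, forall x, `|u x| <= K * g x.
Proof.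
move=> g_gt0 /ereal_inf_lt[_ [V cofV <-] supV].
pose K1 : R := \sum_(x <- finmap.enum_fset (fset_set (~` V))) `|u x| / `|g x|.
have term_ge0 x : 0 <= `|u x| / `|g x| by [].
have [K2 K20 HK2] : exists2 K2 : R, 0 <= K2
    & forall x, V x -> `|u x| / `|g x| <= K2.
  move: supV; case E : (ereal_sup _) => [r| |]// _.
    exists (Num.max 0 r) => [|x Vx]; first by rewrite le_max lexx.
    rewrite le_max -[X in _ || X]lee_fin -E; apply/orP; right.
    by apply: ereal_sup_ubound; exists x.
  exists 0 => // x Vx; have : ((`|u x| / `|g x|)%:E <= -oo)%E.
    by rewrite -E; apply: ereal_sup_ubound; exists x.
  by rewrite leeNy_eq.
have K10 : 0 <= K1 by rewrite sumr_ge0.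
exists (K1 + K2) => x; rewrite -ler_pdivrMr// -[X in _ / X](gtr0_norm (g_gt0 x)).
have [Vx|nVx] := pselect (V x).
  by apply: le_trans (HK2 x Vx) _; rewrite lerDr.
apply: (@le_trans _ _ K1); last by rewrite lerDl.
rewrite /K1 (big_rem x) ?lerDl ?sumr_ge0//=.
by rewrite in_fset_set// inE.
Qed.

Lemma limf_einf_at_infinity_ge (f : X -> \bar R) (r : \bar R) :
  (forall x, r <= f x)%E -> (r <= limf_einf f (@at_infinity X))%E.
Proof.
move=> rf; rewrite limf_einfE; apply: ereal_sup_ge.
exists (ereal_inf (f @` setT)); last by apply: le_ereal_inf_tmp => _ [x _ <-].
by exists setT => //; rewrite /at_infinity /= setCT.
Qed.

End AtInfinity.

(** * Positive parts of harmonic functions *)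

Section PositivePart.
Context {R : realType} {X : discreteTopologicalType}.
Variables (b : X -> X -> R) (bG : is_graph b) (m : X -> R).
Hypothesis m_gt0 : forall x, 0 < m x.
Let b_ge0 x y : 0 <= b x y. Proof. by case: bG. Qed.
Implicit Types (f g u V : X -> R) (x y : X).

Lemma in_domain_le f g : (forall x, `|f x| <= `|g x|) ->
  in_domain b g -> in_domain b f.
Proof.
move=> fg dg x; apply: le_lt_trans (dg x); apply: le_esum => y _.
by rewrite lee_fin ler_wpM2l.
Qed.

Lemma summable_difference f x : in_domain b f ->
  summable [set: X] (EFin \o (fun y => b x y * (f x - f y))).
Proof.
move=> df; apply: (@le_lt_trans _ _
  ((degree b x * `|f x|)%:E + \esum_(y in [set: X]) (b x y * `|f y|)%:E)%E).
  rewrite -neighbor_sum_cst// -esumD.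
  - apply: le_esum => y _ /=; rewrite -EFinD lee_fin normrM (ger0_norm (b_ge0 _ _)).
    by rewrite -mulrDr ler_wpM2l// ler_normB.
  - by move=> y _; rewrite lee_fin mulr_ge0.
  - by move=> y _; rewrite lee_fin mulr_ge0.
by rewrite lte_add_pinfty ?ltry.
Qed.

Lemma le_laplacian f g x : in_domain b f -> in_domain b g ->
  (forall y, f y <= g y) -> f x = g x ->
  laplacian b m g x <= laplacian b m f x.
Proof.
move=> df dg fg fgx; rewrite /laplacian ler_pM2l ?invr_gt0//.
apply: le_real_sum; try exact: summable_difference.
by move=> y; rewrite fgx ler_wpM2l// lerB.
Qed.

Lemma laplacianN f x : in_domain b f ->
  laplacian b m (fun y => - f y) x = - laplacian b m f x.
Proof.
move=> df; rewrite /laplacian -mulrN -real_sumN; last exact: summable_difference.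
by congr (_ * real_sum _); apply/funext => y; rewrite -opprD mulrN.
Qed.

Lemma schrodinger_harmonicN V u : schrodinger_harmonic b m V u ->
  schrodinger_harmonic b m V (fun x => - u x).
Proof.
move=> [du Hu]; split=> [|x].
  by apply: in_domain_le du => x; rewrite normrN.
by rewrite /schrodinger laplacianN// mulrN -opprD -/(schrodinger b m V u x) Hu oppr0.
Qed.

Definition positive_part u x : R := Num.max 0 (u x).

Lemma positive_part_domain u : in_domain b u -> in_domain b (positive_part u).
Proof.
apply: in_domain_le => x; rewrite /positive_part.
by have [u0|u0] := leP 0 (u x); rewrite ?normr0.
Qed.

(** Where [u > 0], passing to the positive part leaves the value unchanged and
    raises the neighbours, hence lowers the Laplacian. *)
Lemma positive_part_subharmonic V u x : schrodinger_harmonic b m V u ->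
  0 < positive_part u x ->
  (((degree b x + m x * V x) * positive_part u x)%:E
     <= neighbor_sum b (positive_part u) x)%E.
Proof.
move=> [du Hu] px; have dp := positive_part_domain du.
have p0 y : 0 <= positive_part u y by rewrite le_max lexx.
have pu y : u y <= positive_part u y by rewrite le_max lexx orbT.
have upx : u x = positive_part u x.
  move: px; rewrite /positive_part; have [u0|u0] := leP 0 (u x) => //.
  by rewrite ltxx.
have fin := neighbor_sum_fin_num bG x p0 dp.
have lapE := laplacian_ge0E bG (lt0r_neq0 (m_gt0 x)) p0 dp.
have lap_le := ler_wpM2l (ltW (m_gt0 x)) (le_laplacian du dp pu upx).
have := Hu x; rewrite /schrodinger upx => /(congr1 (fun t => m x * t)).
rewrite mulr0 mulrDr mulrA => Hx.
rewrite -(fineK fin) lee_fin; lra.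
Qed.

End PositivePart.

(** * Comparison with the Green function of Delta + 1 *)

Section GreenComparison.
Context {R : realType} {X : discreteTopologicalType}.
Variables (m : X -> R) (m_gt0 : forall x, 0 < m x).
Variables (b : X -> X -> R) (bG : is_graph b).
Variables (conn : connected_graph b) (Xinf : infinite_set [set: X]).
Variables (V : X -> R) (V_le1 : forall x, V x <= 1).
Variable o : X.

(** [(Delta + 1) u = (1 - V) u >= 0], so [green_le_superharmonic] applies. *)
Lemma positive_harmonic_ge_green u : schrodinger_harmonic b m V u ->
  (forall x, 0 < u x) ->
  forall x, u o / green b m 1 o o <= `|u x| / green b m 1 o x.
Proof.
move=> [du Hu] u_gt0 x.
have G_gt0 y : 0 < green b m 1 o y by exact: green_gt0.
have u_ge0 y : 0 <= u y by exact: ltW.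
have u_super y : (neighbor_sum b u y <= ((degree b y + m y * 1) * u y)%:E)%E.
  have := schrodinger_ge_neighbor_sum bG V 0 (m_gt0 y) u_ge0 du.
  rewrite Hu lexx mulr0 add0e => /esym/le_trans; apply.
  by rewrite lee_fin ler_wpM2r// lerD2l ler_wpM2l// ltW.
have G_le := green_le_superharmonic m_gt0 bG conn o x ltr01 u_gt0 u_super.
rewrite gtr0_norm// ler_pdivlMr// mulrAC ler_pdivrMr//.
apply: le_trans (ler_wpM2l (u_ge0 o) G_le) _.
by rewrite [leLHS]mulrA [u o * _]mulrC divfK ?gt_eqF// mulrC.
Qed.

(** If [u] is positive somewhere, its positive part is a positive multiple of
    [v], so [u] is positive everywhere and dominates a multiple of [G_1]. *)
Lemma harmonic_nonpositive (H_positive : positive_operator b m V)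
  (Delta_subcritical : subcritical b m (fun=> 0))
  (G0_proper : proper_fun (green0 b m o)) u :
  in_bigO u (fun x => Num.sqrt (green0 b m o x)) ->
  schrodinger_harmonic b m V u ->
  limf_einf (fun x => (`|u x| / green b m 1 o x)%:E) (@at_infinity X) = 0%E ->
  forall x, u x <= 0.
Proof.
move=> uO uH u_liminf x; rewrite leNgt; apply/negP => ux.
have G_gt0 := green0_gt0 m_gt0 bG conn Xinf Delta_subcritical o.
have [|K HK] := in_bigO_bound _ uO; first by move=> y; rewrite sqrtr_gt0.
have [v [v_ge0 [z vz]] [dv Hv]] := H_positive.
pose c y := degree b y + m y * V y.
have v_super y : (neighbor_sum b v y <= (c y * v y)%:E)%E.
  have := Hv y; rewrite (schrodinger_ge_neighbor_sum bG)// mulr0 add0e.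
  exact.
have v_gt0 : forall y, 0 < v y.
  by apply: (superharmonic_gt0 bG conn v_ge0 v_super (x := z)); rewrite lt0r vz v_ge0.
have du := uH.1.
have w_ge0 y : 0 <= positive_part u y by rewrite le_max lexx.
have w_le y : positive_part u y <= K * Num.sqrt (green0 b m o y).
  apply: le_trans (HK y); rewrite ge_max normr_ge0 /=; exact: ler_norm.
have G_le := green0_le_pole m_gt0 bG conn Xinf Delta_subcritical o.
have ratio := ratio_constant bG v_gt0 w_ge0 
  v_super (fun y => @positive_part_subharmonic _ _ _ bG _ m_gt0 V u y uH)
  conn (fun y => sqrtr_ge0 _) w_le (fun n y => clamp_ge0 _)
  (fun n => cutoff_finitely_supported G_gt0 G_le G0_proper n)
  (cutoff_eventually1 _)
  (fun n => cutoff_energy m_gt0 bG G_gt0 G_le G0_proper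
     (green0_in_domain m_gt0 bG conn Xinf Delta_subcritical o)
     (green0_subsolution m_gt0 bG conn Xinf Delta_subcritical o) n).
have wx : 0 < positive_part u x by rewrite lt_max ux orbT.
have u_gt0 y : 0 < u y.
  have : 0 < positive_part u y.
    by rewrite -(pmulr_lgt0 _ (_ : 0 < (v y)^-1)) ?invr_gt0// -(ratio x) divr_gt0.
  by rewrite lt_max ltxx.
have ratio_ge y : ((u o / green b m 1 o o)%:E
    <= (`|u y| / green b m 1 o y)%:E)%E.
  by rewrite lee_fin; exact: positive_harmonic_ge_green.
have := limf_einf_at_infinity_ge ratio_ge.
by rewrite u_liminf lee_fin leNgt divr_gt0 ?green_gt0.
Qed.

End GreenComparison.

Theorem corollary3p4 (R : realType) (X : discreteTopologicalType)
  (X_countable : countable [set: X]) (X_infinite : infinite_set [set: X])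
  (m : X -> R) (m_gt0 : forall x, 0 < m x)
  (b : X -> X -> R) (b_graph : is_graph b) (b_connected : connected_graph b)
  (V : X -> R) (V_le1 : forall x, V x <= 1)
  (H_positive : positive_operator b m V)
  (o : X)
  (Delta_subcritical : subcritical b m (fun=> 0))
  (G0_proper : proper_fun (green0 b m o))
  (G0_oscillation : bounded_oscillation b (green0 b m o))
  (u : X -> R)
  (u_bigO : in_bigO u (fun x => Num.sqrt (green0 b m o x)))
  (u_harmonic : schrodinger_harmonic b m V u)
  (u_liminf :
    limf_einf (fun x => (`|u x| / green b m 1 o x)%:E) (@at_infinity X) = 0%E) :
  forall x, u x = 0.
Proof.
move=> x; apply/eqP; rewrite eq_le; apply/andP; split.
  exact: harmonic_nonpositive u_bigO u_harmonic u_liminf x.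
rewrite -oppr_le0.
apply: (@harmonic_nonpositive _ _ m _ b _ _ _ V _ o _ _ _ (fun y => - u y)) => //.
- rewrite /in_bigO (_ : (fun y => _) = (fun y =>
    (`|u y| / `|Num.sqrt (green0 b m o y)|)%:E))//.
  by apply/funext => y; rewrite normrN.
- exact: schrodinger_harmonicN.
- by rewrite -[RHS]u_liminf; congr limf_einf; apply/funext => y; rewrite normrN.
Qed.
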